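(* Define upper triangular matrices $A^{(1)}$ and $A^{(2)}$, both with zero main diagonal, by $$(A^{(1)})_k^{\,l}=\frac{\delta_{l,k}}{k},\qquad (A^{(2)})_k^{\,l}=\frac{\delta_{l,1}}{k}\qquad (k\ge1,\ l\ge1),$$ so that $A^{(1)}$ carries the entry $1/k$ at position $(k,2k)$ and $A^{(2)}$ carries it at position $(1,1+k)$ ($k\ge1$). Then: (i) for every $k\ge0$ the diagonals $A^{(1)}_k$ and $A^{(2)}_k$ coincide up to a permutation of their entries, and $A^{(1)},A^{(2)}\in\mathcal{M}_{S_1}(2,1)$; (ii) $A^{(1)}\notin\mathcal{B}(D,\ell_2)^K$: the matrix $B:=\sum_{k\ge1}E_{k,2k}$ (with $E_{j,m}$ the matrix units) satisfies $\|B\|_{\mathcal{B}(D,\ell_2)}\le2$, while the pairing $\sum_{j,m}|(A^{(1)})_{j,m}b_{j,m}|$ is the harmonic series $\sum_{k\ge1}1/k$; (iii) $A^{(2)}\in\mathcal{B}(D,\ell_2)^K$, and there is an absolute constant $C$ such that $\sum_{j,m}|(A^{(2)})_{j,m}\,b_{j,m}|\le C\|B\|_{\mathcal{B}(D,\ell_2)}$ for every $B\in\mathcal{B}(D,\ell_2)$.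
   Context: All matrices are infinite complex matrices $A=(a_{j,m})_{j,m\ge1}$, upper triangular: $a_{j,m}=0$ for $m<j$. For $k\ge0$ the $k$-th diagonal $A_k$ is the matrix agreeing with $A$ on the entries $(l,l+k)$, $l\ge1$, and vanishing elsewhere; $(A)_k^{\,l}=a_k^{\,l}:=a_{l,l+k}$ denotes its $l$-th entry. Put $\|A_k\|_{S_1}=\sum_l|a_k^{\,l}|$ and $\|A_k\|_{B(\ell_2)}=\sup_l|a_k^{\,l}|$. Dyadic blocks: $I_0=\{0,1\}$ and $I_n=\{k:2^n\le k<2^{n+1}\}$ for $n\ge1$. $\mathcal{M}_{S_1}(2,1)$ is the space of upper triangular $A$ with $\sum_{n\ge0}\bigl(\sum_{k\in I_n}\|A_k\|_{S_1}^2\bigr)^{1/2}<\infty$. Matricial Bloch space: for $0\le r<1$ let $A'(r)=\sum_{k\ge1}kA_kr^{k-1}$ (entrywise), required to define a bounded operator on $\ell_2$ for each $r$. $\mathcal{B}(D,\ell_2)$ is the space of upper triangular $A$ with $\|A\|_{\mathcal{B}(D,\ell_2)}:=\sup_{0\le r<1}(1-r^2)\|A'(r)\|_{B(\ell_2)}+\|A_0\|_{B(\ell_2)}<\infty$. Köthe dual: $\mathcal{B}(D,\ell_2)^K$ is the set of upper triangular $A$ such that $\sum_{j,m}|a_{j,m}b_{j,m}|<\infty$ for every $B=(b_{j,m})\in\mathcal{B}(D,\ell_2)$. *)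

(* Defs.v *)
From mathcomp Require Import all_boot all_order all_algebra.
From mathcomp Require Import all_classical all_reals all_analysis.
From mathcomp Require Import complex.

Set Implicit Arguments.
Unset Strict Implicit.
Unset Printing Implicit Defensive.

Import Order.TTheory GRing.Theory Num.Theory numFieldNormedType.Exports.
Import Normc.

Local Open Scope classical_set_scope.
Local Open Scope ring_scope.

(* Rows and columns are numbered from 0: [A j m] is the entry in row [j.+1]
   and column [m.+1] of the usual 1-based numbering.  Diagonals keep their
   usual number [k = m - j], which is not affected by the shift. *)
Definition imx (R : realType) := nat -> nat -> R[i].

Section InfiniteMatrices.
Variable R : realType.
Implicit Types (A B T : imx R) (x : nat -> R[i]).

Definition upper_triangular A := forall j m, (m < j)%N -> A j m = 0.

(* [dentry A k l] is the [l.+1]-th entry of the [k]-th diagonal. *)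
Definition dentry A (k l : nat) : R[i] := A l (l + k)%N.

Definition diagonal A (k : nat) : imx R :=
  fun j m => if m == (j + k)%N then A j m else 0.

(* The upper triangular matrix with [dentry _ k l = d k l]. *)
Definition of_diagonals (d : nat -> nat -> R[i]) : imx R :=
  fun j m => if (j <= m)%N then d (m - j)%N j else 0.

Definition diag_S1_norm A (k : nat) : \bar R :=
  (\sum_(0 <= l <oo) (normc (dentry A k l))%:E)%E.

Definition diag_sup_norm A (k : nat) : \bar R :=
  ereal_sup (range (fun l => (normc (dentry A k l))%:E)).

(* [I_n] is the set of [k] with [dyadic_min n <= k < 2 ^ n.+1]. *)
Definition dyadic_min (n : nat) : nat := if n == 0%N then 0%N else (2 ^ n)%N.

Definition M_S1_21 : set (imx R) :=
  [set A | upper_triangular A /\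
    (\sum_(0 <= n <oo)
       sqrte (\sum_(dyadic_min n <= k < 2 ^ n.+1) diag_S1_norm A k ^+ 2)
     < +oo)%E].

Definition l2_norm x : \bar R :=
  sqrte (\sum_(0 <= m <oo) (normc (x m) ^+ 2)%:E)%E.

Definition row_terms T x (j : nat) : nat -> R[i]^o := fun m => T j m * x m.

Definition imx_apply T x : nat -> R[i] := fun j => limn (series (row_terms T x j)).

Definition bounded_on_l2 T :=
  exists M : R, forall x, (l2_norm x < +oo)%E ->
    (forall j, cvgn (series (row_terms T x j))) /\
    (l2_norm (imx_apply T x) <= M%:E * l2_norm x)%E.

(* Meaningful for matrices satisfying [bounded_on_l2]. *)
Definition op_norm T : \bar R :=
  ereal_sup [set l2_norm (imx_apply T x) | x in [set x | (l2_norm x <= 1)%E]].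

(* The entrywise sum of the matrices [k A_k r^(k-1)] over [k >= 1]; it stops
   at [k = m] because [A_k] has no nonzero entry in column [m] for [m < k]. *)
Definition imx_derive A (r : R) : imx R :=
  fun j m => \sum_(1 <= k < m.+1) k%:R * diagonal A k j m * (r%:C)%C ^+ k.-1.

Definition bloch_norm A : \bar R :=
  (ereal_sup [set (1 - r ^+ 2)%:E * op_norm (imx_derive A r)
             | r in [set r : R | (0 <= r < 1)%R]]
   + diag_sup_norm A 0)%E.

Definition bloch : set (imx R) :=
  [set A | [/\ upper_triangular A,
    (forall r : R, 0 <= r < 1 -> bounded_on_l2 (imx_derive A r)) &
    (bloch_norm A < +oo)%E]].

Definition abs_pairing A B : \bar R :=
  (\esum_(p in [set: nat * nat]) (normc (A p.1 p.2 * B p.1 p.2))%:E)%E.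

Definition kothe_dual (X : set (imx R)) : set (imx R) :=
  [set A | upper_triangular A /\
    forall B, X B -> (abs_pairing A B < +oo)%E].

(* In 1-based numbering the following two matrices have the diagonal entries
   delta_{l,k} / k and delta_{l,1} / k for k >= 1. *)
Definition mxA1 : imx R := of_diagonals (fun k l =>
  if (0 < k)%N && (l.+1 == k) then k%:R^-1 else 0).

Definition mxA2 : imx R := of_diagonals (fun k l =>
  if (0 < k)%N && (l == 0%N) then k%:R^-1 else 0).

(* The sum of the matrix units E_{k,2k}, k >= 1. *)
Definition mxB : imx R := fun j m => (m.+1 == (2 * j.+1)%N)%:R.

End InfiniteMatrices.

Arguments M_S1_21 : clear implicits.
Arguments bloch : clear implicits.
Arguments mxA1 : clear implicits.
Arguments mxA2 : clear implicits.
Arguments mxB : clear implicits.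

(* Main.v *)
(** For B := \sum_k E_{k,2k} the matrix B'(r) is a weighted partial isometry with
    weights k r^(k-1) <= 1 + r + ... + r^(k-1) <= 1/(1-r), so (1-r^2) ||B'(r)|| <= 2,
    whereas its pairing with A^(1) is the harmonic series.

    For A^(2) only the first row b of B matters.  Put q := 2^(-1/2) and
    r := 1 - 2^(-n-1), and apply B'(r) to the unit vector with entries
    q^n conj(b_m)/|b_m| for 2^n <= m < 2^(n+1).  The first coordinate of the
    image is q^n \sum_m m |b_m| r^(m-1), so it is at most ||B||/(1-r^2); as
    r^(m-1) >= 1/4 and m >= 4^n/m on the block, this gives
    \sum_m |b_m|/m <= 8 ||B|| q^n there, and the sum over n is geometric. *)
Require Import Defs.
From mathcomp Require Import all_boot all_order all_algebra.
From mathcomp Require Import all_classical all_reals all_analysis.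
From mathcomp Require Import complex zify ring lra.

Set Implicit Arguments.
Unset Strict Implicit.
Unset Printing Implicit Defensive.

Import Order.TTheory GRing.Theory Num.Theory numFieldNormedType.Exports.
Import Normc.

Local Open Scope classical_set_scope.
Local Open Scope ring_scope.

(** * Rows with finitely many nonzero terms, and the entries of A'(r) *)

Lemma normc_ge0 (R : realType) (z : R[i]) : 0 <= normc z.
Proof. by case: z => a b; rewrite sqrtr_ge0. Qed.

Lemma series_finite_support (R : realType) (u : nat -> R[i]^o) (M : nat) :
  (forall m, (M <= m)%N -> u m = 0) ->
  series u @ \oo --> (\sum_(0 <= m < M) u m : R[i]^o).
Proof.
move=> u0; apply: cvg_near_cst; exists M => // n /= Mn.
rewrite /series/= (big_cat_nat (n := M))//= [X in _ + X]big_nat.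
by rewrite [X in _ + X]big1 ?addr0// => m /andP[/u0].
Qed.

(** The row series is eventually constant. This covers both uses below: finitely supported test
    vectors, and rows of [T] with finite support. *)
Lemma imx_apply_finite (R : realType) (T : imx R) x (M j : nat) :
  (forall m, (M <= m)%N -> T j m * x m = 0) ->
  cvgn (series (row_terms T x j)) /\
  imx_apply T x j = \sum_(0 <= m < M) T j m * x m.
Proof.
move=> /series_finite_support h; split; first by apply/cvg_ex; eexists; exact: h.
exact: (@cvg_lim R[i]^o (@norm_hausdorff _ R[i]^o) _ _ _ _ _ h).
Qed.

(** Only the diagonal [k = m - j] meets position [(j, m)]. On and below the main diagonal truncated
    subtraction makes the factor [(m - j)%:R] zero, in agreement with the sum starting at
    [k = 1]. *)
Lemma imx_deriveE (R : realType) (A : imx R) (r : R) (j m : nat) :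
  imx_derive A r j m = (m - j)%:R * A j m * (r%:C)%C ^+ (m - j).-1.
Proof.
rewrite /imx_derive /Defs.diagonal.
case: (ltnP j m) => jm.
  have mj : (m - j)%N \in index_iota 1 m.+1.
    by rewrite mem_index_iota subn_gt0 jm ltnS leq_subr.
  rewrite (bigD1_seq _ mj) ?iota_uniq//=.
  rewrite subnKC ?(ltnW jm)// eqxx big1 ?addr0// => k kmj.
  case: eqP => [e|]; last by rewrite mulr0 mul0r.
  by move: kmj; rewrite e addnC addnK eqxx.
have /eqP -> : (m - j == 0)%N by rewrite subn_eq0.
rewrite !mul0r big_nat_cond big1// => k; rewrite andbT => /andP[k0 _].
by case: eqP => [e|]; rewrite ?mulr0 ?mul0r//; lia.
Qed.

(** * Series of nonnegative extended reals, and pairings supported on a sequence *)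

Lemma nneseries_finite_support (R : realType) (f : nat -> \bar R) (a b : nat) :
  (a <= b)%N -> (forall k, 0 <= f k)%E ->
  (forall k, ~~ (a <= k < b)%N -> f k = 0%E) ->
  (\sum_(0 <= k <oo) f k = \sum_(a <= k < b) f k)%E.
Proof.
move=> ab f0 fab; rewrite (nneseries_split 0 b)// add0n.
rewrite (big_cat_nat (n := a))//= big_nat big1 ?add0e; last first.
  by move=> k /andP[_ ka]; rewrite fab// negb_and -ltnNge ka.
rewrite eseries0 ?adde0// => k bk _.
by rewrite fab// negb_and -leqNgt bk orbT.
Qed.

Lemma nneseries_single (R : realType) (f : nat -> \bar R) (i : nat) :
  (forall k, 0 <= f k)%E -> (forall k, k != i -> f k = 0%E) ->
  (\sum_(0 <= k <oo) f k = f i)%E.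
Proof.
move=> f0 fi; rewrite (@nneseries_finite_support _ _ i i.+1) ?big_nat1// => k.
by move=> ki; apply: fi; apply: contra ki => /eqP ->; rewrite leqnn ltnSn.
Qed.

(** As an unordered sum, the left side is the sum of [f] over the range of [e]. *)
Lemma nneseries_inj_le (R : realType) (f : nat -> \bar R) (e : nat -> nat) :
  injective e -> (forall k, 0 <= f k)%E ->
  (\sum_(0 <= k <oo) f (e k) <= \sum_(0 <= k <oo) f k)%E.
Proof.
move=> ei f0; rewrite !nneseries_esumT//.
rewrite -(esum_image [set: nat] e f); last by move=> ? ? _ _; exact: ei.
by rewrite esum_mkcond; apply: le_esum => k _; case: ifP.
Qed.

(** Both A^(1) and A^(2) live on an injective sequence of positions, so that their pairings reduce
    to simple series. *)
Lemma abs_pairing_image (R : realType) (A B : imx R) (e : nat -> nat * nat) :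
  injective e -> (forall p, ~ range e p -> A p.1 p.2 = 0) ->
  abs_pairing A B =
  (\sum_(0 <= k <oo) (normc (A (e k).1 (e k).2 * B (e k).1 (e k).2))%:E)%E.
Proof.
move=> ei A0; rewrite nneseries_esumT; last by move=> n; rewrite lee_fin normc_ge0.
rewrite -(esum_image [set: nat] e (fun p => (normc (A p.1 p.2 * B p.1 p.2))%:E));
  last by move=> ? ? _ _; exact: ei.
rewrite [RHS]esum_mkcond; apply: eq_esum => p _; case: ifPn => // /negP pe.
rewrite A0 ?mul0r ?normc0// => ?; by apply: pe; rewrite inE.
Qed.

Lemma nneseries_le_bound (R : realType) (f : nat -> \bar R) (c : \bar R) :
  (forall k, 0 <= f k)%E -> (forall n, \sum_(0 <= k < n) f k <= c)%E ->
  (\sum_(0 <= k <oo) f k <= c)%E.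
Proof.
move=> f0 h; apply: lime_le; first by apply: is_cvg_nneseries.
exact: nearW.
Qed.

Lemma geometric_partial_sum_le (R : realType) (q : R) (n : nat) :
  0 <= q < 1 -> \sum_(0 <= i < n) q ^+ i <= (1 - q)^-1.
Proof.
move=> /andP[q0 q1]; have q1' : 0 < 1 - q by rewrite subr_gt0.
rewrite big_mkord -[leRHS]mul1r ler_pdivlMr// mulrC -opprB mulNr -subrX1 opprB.
by rewrite gerBl exprn_ge0.
Qed.

(** * Moduli, and lower bounds for the operator and Bloch norms *)

Lemma normc_nat (R : realType) (n : nat) : normc (n%:R : R[i]) = n%:R.
Proof. by rewrite normcMn normc1. Qed.

Lemma normc_real (R : realType) (x : R) : normc (x%:C)%C = `|x|.
Proof. by rewrite /normc/= expr0n/= addr0 sqrtr_sqr. Qed.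

Lemma normc_le_l2_norm (R : realType) (y : nat -> R[i]) (j : nat) :
  ((normc (y j))%:E <= l2_norm y)%E.
Proof.
have -> : (normc (y j))%:E = sqrte (normc (y j) ^+ 2)%:E.
  by rewrite /= sqrtr_sqr ger0_norm// normc_ge0.
have h k : (0 <= (normc (y k) ^+ 2)%:E)%E by rewrite lee_fin sqr_ge0.
rewrite lee_sqrt ?nneseries_ge0// (nneseriesD1 (n := j))// leeDl//.
by apply: nneseries_ge0.
Qed.

(** The sum is the [j]-th coordinate of the image of [x], a vector of the unit ball; finite support
    settles the convergence of the row. *)
Lemma row_le_op_norm (R : realType) (T : imx R) (x : nat -> R[i]) (j M : nat) :
  (forall m, (M <= m)%N -> x m = 0) -> (l2_norm x <= 1)%E ->
  ((normc (\sum_(0 <= m < M) T j m * x m))%:E <= op_norm T)%E.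
Proof.
move=> x0 x1; have [|_ <-] := @imx_apply_finite R T x M j.
  by move=> m /x0 ->; rewrite mulr0.
apply: (le_trans (normc_le_l2_norm _ _)).
by apply: ereal_sup_ubound; exists x.
Qed.

Lemma op_norm_le_bloch_norm (R : realType) (A : imx R) (r : R) : 0 <= r < 1 ->
  ((1 - r ^+ 2)%:E * op_norm (imx_derive A r) <= bloch_norm A)%E.
Proof.
move=> r01; rewrite /bloch_norm -[leLHS]adde0; apply: leeD.
  by apply: ereal_sup_ubound; exists r.
apply: (@le_trans _ _ (normc (dentry A 0 0))%:E).
  by rewrite lee_fin normc_ge0.
by apply: ereal_sup_ubound; exists 0%N.
Qed.

(** * Dyadic radii and dyadic blocks *)

Lemma Bernoulli_le (R : realType) (x : R) (n : nat) : 0 <= x <= 1 ->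
  1 - x *+ n <= (1 - x) ^+ n.
Proof.
move=> /andP[x0 x1]; elim: n => [|n ih]; first by rewrite mulr0n subr0 expr0.
rewrite exprS (le_trans _ (ler_wpM2l _ ih)) ?subr_ge0// mulrBr mulr1 mulrSr.
have : 0 <= x * (x *+ n) by rewrite mulr_ge0// mulrn_wge0.
by rewrite mulrBl mul1r; lra.
Qed.

(** Bernoulli at exponent 2^(n+1) would only give 0. At exponent 2^n it gives 1/2, and squaring
    reaches 2^(n+1) with 1/4. *)
Lemma dyadic_radius_expr_ge (R : realType) (n m : nat) : (m <= 2 ^ n.+1)%N ->
  4^-1 <= (1 - (2 ^+ n.+1)^-1 : R) ^+ m.
Proof.
set x := (2 ^+ n.+1)^-1 => mn.
have x01 : 0 <= x <= 1.
  by rewrite invr_ge0 exprn_ge0//= invf_le1 ?exprn_gt0// exprn_ege1// ler1n.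
have /andP[x0 x1] := x01.
have /andP[y0 y1] : 0 <= 1 - x <= 1 by rewrite subr_ge0 x1 gerBl.
apply: (@le_trans _ _ ((1 - x) ^+ (2 ^ n.+1))); last first.
  by apply: ler_wiXn2l.
rewrite expnS mulnC exprM (_ : 4^-1 = 2^-1 ^+ 2); last by rewrite expr2; field.
have h : 2^-1 <= (1 - x) ^+ (2 ^ n).
  apply: le_trans (Bernoulli_le (2 ^ n) x01).
  rewrite -(mulr_natr x) natrX /x exprS invfM -mulrA mulVf ?expf_neq0//; lra.
by rewrite ler_pXn2r// nnegrE ?exprn_ge0//; lra.
Qed.

(** Here block 0 is {1} and not I_0 = {0, 1}; in the sums below the index 0 carries the weight
    [0%:R^-1], which is 0. *)
Lemma sum_dyadic_blocks (V : zmodType) (f : nat -> V) (n : nat) :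
  \sum_(1 <= k < 2 ^ n) f k =
  \sum_(0 <= i < n) \sum_(2 ^ i <= k < 2 ^ i.+1) f k.
Proof.
elim: n => [|n ih]; first by rewrite expn0 !big_geq.
rewrite big_nat_recr//= -ih -big_cat_nat ?expn_gt0//.
by rewrite leq_exp2l.
Qed.

(** * The first row of a Bloch matrix on one dyadic block *)

Lemma sqrt_half_bounds (R : realType) : 0 < Num.sqrt (2^-1 : R) < 1.
Proof.
rewrite sqrtr_gt0 invr_gt0 ltr0n/= -[ltRHS]sqrtr1 ltr_sqrt//.
by rewrite invf_lt1// ltr1n.
Qed.

Lemma sqrt_half_expr_sqr (R : realType) (n : nat) :
  (Num.sqrt (2^-1 : R) ^+ n) ^+ 2 = (2 ^+ n)^-1.
Proof. by rewrite -exprM mulnC exprM sqr_sqrtr ?exprVn// invr_ge0. Qed.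

(* [z^-1 * (normc z)%:C] is the conjugate phase of [z], and [0] at [z = 0]. *)
Definition dyadic_test_vector (R : realType) (b : nat -> R[i]) (n m : nat) : R[i] :=
  if (2 ^ n <= m < 2 ^ n.+1)%N
  then (b m)^-1 * (normc (b m) * Num.sqrt 2^-1 ^+ n)%:C%C else 0.

(** The block has 2^n indices, and each entry has squared modulus 2^(-n), or 0 where [b]
    vanishes. *)
Lemma l2_norm_dyadic_test_vector (R : realType) (b : nat -> R[i]) (n : nat) :
  (l2_norm (dyadic_test_vector b n) <= 1)%E.
Proof.
have -> : 1%E = sqrte (1%:E : \bar R) by rewrite /= sqrtr1.
rewrite lee_sqrt//.
rewrite (@nneseries_finite_support _ _ (2 ^ n) (2 ^ n.+1)) ?leq_exp2l//.
- rewrite sumEFin lee_fin.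
  apply: (@le_trans _ _ (\sum_(2 ^ n <= m < 2 ^ n.+1) (2 ^+ n)^-1 : R)).
    rewrite big_nat [leRHS]big_nat; apply: ler_sum => m nm.
    rewrite /dyadic_test_vector nm normcM normcV normc_real -sqrt_half_expr_sqr.
    rewrite ger0_norm ?mulr_ge0 ?normc_ge0 ?exprn_ge0 ?sqrtr_ge0//.
    rewrite ler_pXn2r ?nnegrE ?mulr_ge0 ?invr_ge0 ?normc_ge0 ?exprn_ge0 ?sqrtr_ge0//.
    rewrite mulrA ler_piMl ?exprn_ge0 ?sqrtr_ge0//.
    by case: (eqVneq (normc (b m)) 0) => [->|/mulVf ->//]; rewrite mulr0.
  rewrite sumr_const_nat expnS mul2n -addnn addnK -(mulr_natr _^-1) natrX.
  by rewrite mulVf// expf_neq0.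
- by move=> k; rewrite lee_fin sqr_ge0.
- by move=> k /negbTE nk; rewrite /dyadic_test_vector nk normc0 expr0n.
Qed.

(** The constant is 8 = 2 * 4: the 2 comes from 1/(1-r^2) <= 2^(n+1) = 2p, the 4 from r^(m-1) >=
    1/4. *)
Lemma bloch_row_block_le (R : realType) (B : imx R) (N : R) (n : nat) :
  (bloch_norm B <= N%:E)%E ->
  \sum_(2 ^ n <= m < 2 ^ n.+1) m%:R^-1 * normc (B 0%N m)
    <= 8 * N * Num.sqrt 2^-1 ^+ n.
Proof.
move=> BN; set q := Num.sqrt _; pose p : R := 2 ^+ n.
have p0 : 0 < p by rewrite exprn_gt0.
have q0 : 0 < q by have /andP[] := sqrt_half_bounds R.
have qn0 : 0 < q ^+ n by rewrite exprn_gt0.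
pose r : R := 1 - (2 ^+ n.+1)^-1.
have t0 : 0 < (2 ^+ n.+1 : R)^-1 by rewrite invr_gt0 exprn_gt0.
have t1 : (2 ^+ n.+1 : R)^-1 <= 1.
  by rewrite invf_le1 ?exprn_gt0// exprn_ege1// ler1n.
have r01 : 0 <= r < 1 by rewrite /r subr_ge0 t1 gtrBl t0.
have /andP[r0 r1] := r01.
pose x := dyadic_test_vector (B 0%N) n.
pose S := \sum_(2 ^ n <= m < 2 ^ n.+1) m%:R * normc (B 0%N m) * r ^+ m.-1 * q ^+ n.
(* The conjugate phases in [x] make every term of row 0 real and nonnegative, so nothing cancels. *)
have SE : \sum_(0 <= m < 2 ^ n.+1) imx_derive B r 0%N m * x m = (S%:C)%C.
  rewrite (big_cat_nat (n := (2 ^ n)%N)) ?leq_exp2l//= big_nat big1 ?add0r; last first.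
    by move=> m /andP[_ mn]; rewrite /x /dyadic_test_vector leqNgt mn mulr0.
  rewrite /S rmorph_sum big_nat [RHS]big_nat; apply: eq_bigr => m nm /=.
  rewrite imx_deriveE subn0 /x /dyadic_test_vector nm !rmorphM !rmorphXn/= rmorph_nat.
  have [B0|B0] := eqVneq (B 0%N m) 0.
    by rewrite B0 normc0 !(mul0r, mulr0).
  by field.
have S0 : 0 <= S.
  by rewrite sumr_ge0// => m _; rewrite !mulr_ge0 ?normc_ge0 ?exprn_ge0// ltW.
have hS : (1 - r ^+ 2) * S <= N.
  rewrite -lee_fin EFinM; apply: le_trans BN.
  apply: le_trans (op_norm_le_bloch_norm B r01).
  rewrite lee_pmul2l// ?lte_fin; last by rewrite subr_gt0 exprn_ilt1.
  have -> : S = normc (S%:C)%C by rewrite normc_real ger0_norm.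
  rewrite -SE.
  apply: row_le_op_norm; last exact: l2_norm_dyadic_test_vector.
  by move=> m nm; rewrite /x /dyadic_test_vector ltnNge nm andbF.
have SN : S <= 2 * p * N.
  have -> : 2 * p = ((2 ^+ n.+1)^-1)^-1 by rewrite invrK exprS.
  rewrite mulrC ler_pdivlMr// (le_trans _ hS)// mulrC ler_wpM2r//.
  (* This is 1 - r^2 = (1-r)(1+r) >= 1-r = 2^(-n-1). *)
  by rewrite /r expr2; nra.
have qq : q ^+ n * q ^+ n = p^-1 by rewrite -expr2 sqrt_half_expr_sqr.
(* The second factor [q ^+ n] combines with the one inside [S] to give 1/p, while the bound on [S]
   leaves 8 N q^n. *)
apply: (@le_trans _ _ (S * (4 * q ^+ n / p))); last first.
  apply: (@le_trans _ _ (2 * p * N * (4 * q ^+ n / p))).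
    by rewrite ler_wpM2r// !mulr_ge0 ?invr_ge0// ltW.
  by rewrite le_eqVlt; apply/orP; left; apply/eqP; field; rewrite gt_eqF.
rewrite /S big_distrl/= big_nat [leRHS]big_nat; apply: ler_sum => m /andP[nm mn].
have m0 : 0 < m%:R :> R by rewrite ltr0n (leq_trans _ nm)// expn_gt0.
have pm : p <= m%:R by rewrite /p -natrX ler_nat.
have rm : 4^-1 <= r ^+ m.-1.
  by apply: dyadic_radius_expr_ge; rewrite (leq_trans (leq_pred m))// ltnW.
have -> : m%:R * normc (B 0%N m) * r ^+ m.-1 * q ^+ n * (4 * q ^+ n / p) =
    (m%:R * (4 * r ^+ m.-1) / p ^+ 2) * normc (B 0%N m).
  transitivity (m%:R * normc (B 0%N m) * r ^+ m.-1 * (4 / p) * (q ^+ n * q ^+ n)).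
    by ring.
  by rewrite qq; field; rewrite gt_eqF.
(* What remains is p^2 <= m^2 * 4 r^(m-1), from p <= m and 4 r^(m-1) >= 1. *)
rewrite ler_wpM2r ?normc_ge0// ler_pdivlMr ?exprn_gt0// ler_pdivrMl//.
have : p ^+ 2 <= m%:R * m%:R by rewrite -expr2 ler_pXn2r// nnegrE ltW.
have : 1 <= 4 * r ^+ m.-1 by lra.
have : 0 <= m%:R * m%:R :> R by rewrite mulr_ge0// ltW.
by nra.
Qed.

(** * The two matrices: entries, membership in M_S1(2,1), permuted diagonals *)

Lemma dentry_of_diagonals (R : realType) (d : nat -> nat -> R[i]) (k l : nat) :
  dentry (of_diagonals d) k l = d k l.
Proof. by rewrite /dentry /of_diagonals leq_addr addnC addnK. Qed.

Lemma upper_triangular_of_diagonals (R : realType) (d : nat -> nat -> R[i]) :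
  upper_triangular (of_diagonals d).
Proof. by move=> j m mj; rewrite /of_diagonals leqNgt mj. Qed.

Lemma mxA1E (R : realType) (j m : nat) :
  mxA1 R j m = if m.+1 == (2 * j.+1)%N then j.+1%:R^-1 else 0.
Proof.
rewrite /mxA1 /of_diagonals; case: (leqP j m) => jm; last first.
  by case: eqP => // h; lia.
case: (eqVneq m.+1 (2 * j.+1)%N) => h.
  have -> : (m - j = j.+1)%N by lia.
  by rewrite eqxx.
by case: ifP => // /andP[_ /eqP] h'; lia.
Qed.

(** At [m = 0] the value [0%:R^-1] is 0, as the zero main diagonal requires. *)
Lemma mxA2E (R : realType) (j m : nat) :
  mxA2 R j m = if j == 0%N then m%:R^-1 else 0.
Proof.
rewrite /mxA2 /of_diagonals; case: (eqVneq j 0%N) => [->|j0].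
  by rewrite subn0 andbT; case: m => //=; rewrite invr0.
by rewrite andbF; case: ifP.
Qed.

Lemma normc_natV (R : realType) (k : nat) : normc (k%:R^-1 : R[i]) = k%:R^-1.
Proof. by rewrite normcV normc_nat. Qed.

Lemma diag_S1_norm_single (R : realType) (A : imx R) (k i : nat) :
  (forall l, l != i -> dentry A k l = 0) ->
  diag_S1_norm A k = (normc (dentry A k i))%:E.
Proof.
move=> Ai; apply: nneseries_single => [l|l /Ai ->]; first by rewrite lee_fin normc_ge0.
by rewrite normc0.
Qed.

(** On I_n there are 2^n nonzero diagonal norms, each at most 2^(-n), so the block contributes at
    most 2^(-n/2) = q^n, a geometric series. *)
Lemma M_S1_21_diag_inv (R : realType) (A : imx R) : upper_triangular A ->
  (forall k, diag_S1_norm A k = (k%:R^-1)%:E) -> M_S1_21 R A.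
Proof.
move=> Au Ak; split => //; have /andP[q0 q1] := sqrt_half_bounds R.
set q := Num.sqrt _ in q0 q1.
have sq n : (0 <= sqrte (\sum_(dyadic_min n <= k < 2 ^ n.+1) diag_S1_norm A k ^+ 2))%E.
  exact: sqrte_ge0.
apply: (@le_lt_trans _ _ ((1 - q)^-1)%:E); last exact: ltry.
apply: nneseries_le_bound => // n.
apply: (@le_trans _ _ (\sum_(0 <= i < n) (q ^+ i)%:E)%E); last first.
  by rewrite sumEFin lee_fin geometric_partial_sum_le// ltW.
apply: lee_sum => i _.
rewrite -[leRHS]gee0_abs ?lee_fin ?exprn_ge0 ?(ltW q0)// -sqrte_sqr.
rewrite -EFin_expe sqrt_half_expr_sqr lee_sqrt ?lee_fin ?invr_ge0 ?exprn_ge0//.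
under eq_bigr do rewrite Ak -EFin_expe.
rewrite sumEFin lee_fin.
(* The two ranges differ only for [i = 0], by the vanishing term [k = 0]. *)
have -> : \sum_(dyadic_min i <= k < 2 ^ i.+1) (k%:R^-1 : R) ^+ 2 =
          \sum_(2 ^ i <= k < 2 ^ i.+1) (k%:R^-1) ^+ 2.
  case: i => [|//]; rewrite /dyadic_min eqxx expn0 expn1 big_ltn// invr0.
  by rewrite expr0n add0r.
apply: (@le_trans _ _ (\sum_(2 ^ i <= m < 2 ^ i.+1) (2 ^+ i)^-1 ^+ 2 : R)).
  rewrite big_nat [leRHS]big_nat; apply: ler_sum => m /andP[im _].
  have m0 : 0 < m%:R :> R by rewrite ltr0n (leq_trans _ im)// expn_gt0.
  rewrite ler_pXn2r ?nnegrE ?invr_ge0 ?exprn_ge0//.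
  by rewrite lef_pV2 ?posrE ?exprn_gt0// -natrX ler_nat.
rewrite sumr_const_nat expnS mul2n -addnn addnK -(mulr_natr _ (2 ^ i)) natrX.
by rewrite expr2 -mulrA mulVf ?mulr1// expf_neq0.
Qed.

Lemma mxA1_M_S1_21 (R : realType) : M_S1_21 R (mxA1 R).
Proof.
apply: M_S1_21_diag_inv => [|k]; first exact: upper_triangular_of_diagonals.
rewrite (@diag_S1_norm_single _ _ _ k.-1) => [|l lk].
  rewrite dentry_of_diagonals; case: k => [|k].
    by rewrite ltnn normc0 invr0.
  by rewrite ltn0Sn eqxx normc_natV.
by rewrite dentry_of_diagonals; case: ifP => // /andP[_ /eqP h]; rewrite -h eqxx in lk.
Qed.

Lemma mxA2_M_S1_21 (R : realType) : M_S1_21 R (mxA2 R).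
Proof.
apply: M_S1_21_diag_inv => [|k]; first exact: upper_triangular_of_diagonals.
rewrite (@diag_S1_norm_single _ _ _ 0%N) => [|l l0].
  rewrite dentry_of_diagonals; case: k => [|k].
    by rewrite ltnn normc0 invr0.
  by rewrite ltn0Sn eqxx normc_natV.
by rewrite dentry_of_diagonals (negbTE l0) andbF.
Qed.

Lemma diagonals_permuted (R : realType) (k : nat) :
  exists2 s : nat -> nat, bijective s &
    forall l, dentry (mxA1 R) k (s l) = dentry (mxA2 R) k l.
Proof.
(* The transposition of the two positions that carry 1/k, numbered from 0; it is the identity for
   [k = 0] and [k = 1]. *)
pose s l := if l == 0%N then k.-1 else if l == k.-1 then 0%N else l.
have sK : involutive s.
  move=> l; rewrite /s; case: (eqVneq l 0%N) => [->|l0].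
    by rewrite eqxx; case: eqP.
  by case: (eqVneq l k.-1) => [->|lk]//; rewrite (negbTE l0) (negbTE lk).
exists s; first exact: inv_bij.
move=> l; rewrite !dentry_of_diagonals /s {sK s}; case: k => [//|k] /=.
case: (eqVneq l 0%N) => [_|l0]; first by rewrite eqxx.
case: (eqVneq l k) => [lk|lk]; last by rewrite eqSS (negbTE lk).
by rewrite eqSS; case: eqP => // k0; rewrite lk -k0 in l0.
Qed.

(** * The Bloch norm of B = \sum_k E_{k,2k} *)

(** Norm bound for a weighted partial isometry: by injectivity of [e], each coordinate of [x] is
    used at most once. *)
Lemma l2_norm_le_comp (R : realType) (x y : nat -> R[i]) (e : nat -> nat) (K : R) :
  injective e -> 0 <= K -> (forall j, normc (y j) <= K * normc (x (e j))) ->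
  (l2_norm y <= K%:E * l2_norm x)%E.
Proof.
move=> ei K0 yx; rewrite -[K%:E]gee0_abs ?lee_fin// -sqrte_sqr -sqrteM; last first.
  by rewrite -EFin_expe lee_fin sqr_ge0.
have x0 k : (0 <= (normc (x k) ^+ 2)%:E)%E by rewrite lee_fin sqr_ge0.
have xx0 : (0 <= \sum_(0 <= k <oo) (normc (x k) ^+ 2)%:E)%E by exact: nneseries_ge0.
have KK0 : (0 <= K%:E ^+ 2)%E by rewrite -EFin_expe lee_fin sqr_ge0.
rewrite lee_sqrt ?mule_ge0//.
apply: (@le_trans _ _ (K%:E ^+ 2 * \sum_(0 <= k <oo) (normc (x (e k)) ^+ 2)%:E)%E).
  rewrite -EFin_expe -nneseriesZl//.
  apply: lee_nneseries => [k _ _|k _]; first by rewrite lee_fin sqr_ge0.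
  rewrite -EFinM lee_fin -exprMn ler_pXn2r ?nnegrE ?mulr_ge0 ?normc_ge0//.
rewrite lee_wpmul2l//.
exact: (@nneseries_inj_le _ (fun k => (normc (x k) ^+ 2)%:E)).
Qed.

Lemma imx_derive_mxBE (R : realType) (r : R) (j m : nat) :
  imx_derive (mxB R) r j m =
  if m.+1 == (2 * j.+1)%N then (j.+1%:R * r ^+ j)%:C%C else 0.
Proof.
rewrite imx_deriveE /mxB; case: eqP => h; last by rewrite mulr0 mul0r.
have -> : (m - j = j.+1)%N by lia.
by rewrite mulr1 rmorphM rmorphXn/= rmorph_nat.
Qed.

Lemma succ_expr_le (R : realType) (r : R) (j : nat) : 0 <= r < 1 ->
  j.+1%:R * r ^+ j <= (1 - r)^-1.
Proof.
move=> r01; apply: le_trans (geometric_partial_sum_le j.+1 r01).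
have /andP[r0 r1] := r01.
have -> : j.+1%:R * r ^+ j = \sum_(0 <= i < j.+1) r ^+ j.
  by rewrite sumr_const_nat subn0 mulr_natl.
rewrite big_nat [leRHS]big_nat; apply: ler_sum => i; rewrite ltnS => ij.
by rewrite ler_wiXn2l// ltW.
Qed.

(** Row [j] of B'(r) is supported in column 2j+1, with weight (j+1) r^j. The result serves both
    [bounded_on_l2] and the bound on [op_norm]. *)
Lemma imx_apply_derive_mxB (R : realType) (r : R) (x : nat -> R[i]) :
  0 <= r < 1 ->
  (forall j, cvgn (series (row_terms (imx_derive (mxB R) r) x j))) /\
  (l2_norm (imx_apply (imx_derive (mxB R) r) x) <= ((1 - r)^-1)%:E * l2_norm x)%E.
Proof.
move=> r01; have /andP[r0 r1] := r01.
have h j := @imx_apply_finite R (imx_derive (mxB R) r) x (2 * j.+1) j.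
have {}h j : cvgn (series (row_terms (imx_derive (mxB R) r) x j)) /\
    imx_apply (imx_derive (mxB R) r) x j = (j.+1%:R * r ^+ j)%:C%C * x (2 * j).+1.
  have [m jm|cvj ->] := h j.
    by rewrite imx_derive_mxBE gtn_eqF ?mul0r// ltnS.
  split => //; rewrite mulnS addSn add1n big_nat_recr//= big_nat big1 ?add0r.
    by rewrite imx_derive_mxBE mulnS eqxx.
  move=> m /andP[_ mj]; rewrite imx_derive_mxBE; case: eqP => [e|]; last by rewrite mul0r.
  by lia.
split; first by move=> j; have [] := h j.
apply: (@l2_norm_le_comp _ _ _ (fun j => (2 * j).+1)).
- by move=> i j; lia.
- by rewrite invr_ge0 subr_ge0 ltW.
- move=> j; have [_ ->] := h j; rewrite normcM normc_real ler_wpM2r ?normc_ge0//.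
  by rewrite ger0_norm ?mulr_ge0 ?exprn_ge0// succ_expr_le.
Qed.

Lemma diag_sup_norm_mxB (R : realType) : diag_sup_norm (mxB R) 0 = 0%E.
Proof.
have B0 l : dentry (mxB R) 0 l = 0.
  by rewrite /dentry /mxB addn0; case: eqP => // h; lia.
rewrite /diag_sup_norm [X in ereal_sup X](_ : _ = [set 0%E]) ?ereal_sup1//.
apply/seteqP; split => [_ [l _ <-]|_ ->] /=; first by rewrite B0 normc0.
by exists 0%N => //; rewrite B0 normc0.
Qed.

Lemma bloch_norm_mxB (R : realType) : (bloch_norm (mxB R) <= 2%:E)%E.
Proof.
rewrite /bloch_norm diag_sup_norm_mxB adde0; apply: ge_ereal_sup => _ [r /= r01 <-].
have /andP[r0 r1] := r01.
have r1' : 0 < 1 - r by rewrite subr_gt0.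
apply: (@le_trans _ _ ((1 - r ^+ 2)%:E * ((1 - r)^-1)%:E)%E).
  rewrite lee_wpmul2l ?lee_fin ?subr_ge0 ?exprn_ile1 ?(ltW r1)//.
  apply: ge_ereal_sup => _ [x /= x1 <-].
  have [_ /le_trans->//] := imx_apply_derive_mxB x r01.
  by rewrite -[leRHS]mule1 lee_wpmul2l// lee_fin invr_ge0 ltW.
(* The quotient (1-r^2)/(1-r) is 1+r, whence the constant 2. *)
rewrite -EFinM lee_fin ler_pdivrMr//.
by rewrite expr2; nra.
Qed.

Lemma mxB_bloch (R : realType) : bloch R (mxB R).
Proof.
split; last by apply: le_lt_trans (bloch_norm_mxB R) _; exact: ltry.
  by move=> j m mj; rewrite /mxB; case: eqP => // h; lia.
move=> r r01; exists (1 - r)^-1 => x _.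
exact: imx_apply_derive_mxB.
Qed.

(** * The pairings of A^(1) with B and of A^(2) with Bloch matrices *)

Lemma normc_mxA1_mxB (R : realType) (j m : nat) :
  normc (mxA1 R j m * mxB R j m) =
  if m.+1 == (2 * j.+1)%N then j.+1%:R^-1 else 0.
Proof.
rewrite mxA1E /mxB; case: eqP => _; last by rewrite mul0r normc0.
by rewrite mulr1 normc_natV.
Qed.

Lemma abs_pairing_mxA1_mxB (R : realType) :
  abs_pairing (mxA1 R) (mxB R) = (\sum_(0 <= k <oo) (harmonic k)%:E)%E.
Proof.
(* The position (k, 2k) for k = j+1, with both indices lowered by one; [harmonic j] is 1/(j+1). *)
rewrite (@abs_pairing_image _ _ _ (fun j => (j, (2 * j).+1))) => [|i j []//|[j m] jm].
  apply: eq_eseriesr => k _ /=.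
  by rewrite normc_mxA1_mxB mulnS eqxx.
rewrite mxA1E /=; case: eqP => // e; exfalso; apply: jm; exists j => //.
by congr pair; lia.
Qed.

(** A finite value would make the harmonic terms summable, hence their real series convergent. *)
Lemma harmonic_nneseries (R : realType) :
  (\sum_(0 <= k <oo) (harmonic k : R)%:E = +oo)%E.
Proof.
apply/eqP; rewrite -leye_eq leNgt; apply/negP => h.
apply: (@dvg_harmonic R).
have := @summable_cvg R xpredT (fun k => (harmonic k)%:E).
apply.
  by move=> k _; rewrite lee_fin harmonic_ge0.
rewrite /summable -nneseries_esum//=.
by under eq_eseriesr do rewrite ger0_norm ?invr_ge0//.
Qed.

Lemma abs_pairing_mxA2_le (R : realType) (B : imx R) : bloch R B ->
  (abs_pairing (mxA2 R) B
    <= (8 * (1 - Num.sqrt (2^-1 : R))^-1)%:E * bloch_norm B)%E.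
Proof.
move=> [_ _ BN]; have /andP[q0 q1] := sqrt_half_bounds R.
set q := Num.sqrt _ in q0 q1 *.
(* Nonnegativity, seen at r = 0 on the zero vector, together with finiteness lets the norm be
   replaced by a real [N]. *)
have B0 : (0 <= bloch_norm B)%E.
  apply: le_trans (op_norm_le_bloch_norm B (r := 0) _); last by rewrite lexx ltr01.
  rewrite mule_ge0 ?lee_fin ?subr_ge0 ?expr0n//.
  apply: (@le_trans _ _ (l2_norm (imx_apply (imx_derive B 0) (fun=> 0)))).
    exact: sqrte_ge0.
  apply: ereal_sup_ubound; exists (fun=> 0) => //=.
  by rewrite /l2_norm eseries0 ?sqrte0// => i _ _; rewrite normc0 expr0n.
have BF : bloch_norm B \is a fin_num by rewrite ge0_fin_numE.
rewrite -(fineK BF) -EFinM; set N := fine _.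
have N0 : 0 <= N by rewrite fine_ge0.
rewrite (@abs_pairing_image _ _ _ (fun k => (0%N, k))) => [|i j []//|[j m] jm]; last first.
  rewrite mxA2E /=; case: eqP => // j0; exfalso; apply: jm.
  by exists m => //; rewrite j0.
have f0 k : 0 <= k%:R^-1 * normc (B 0%N k) by rewrite mulr_ge0 ?invr_ge0 ?normc_ge0.
under eq_eseriesr do rewrite /= mxA2E eqxx normcM normc_natV.
apply: nneseries_le_bound => // n; rewrite sumEFin lee_fin.
(* The index 0 contributes 0, and enlarging the range to 2^n >= n leaves only complete blocks. *)
apply: (@le_trans _ _ (\sum_(1 <= k < 2 ^ n) k%:R^-1 * normc (B 0%N k))).
  case: n => [|n]; first by rewrite expn0 !big_geq.
  rewrite big_ltn// invr0 mul0r add0r.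
  rewrite [leRHS](big_cat_nat (n := n.+1))//=; last by rewrite ltnW// ltn_expl.
  by rewrite lerDl sumr_ge0.
rewrite sum_dyadic_blocks.
apply: (@le_trans _ _ (\sum_(0 <= i < n) 8 * N * q ^+ i)).
  by apply: ler_sum => i _; apply: bloch_row_block_le; rewrite /N fineK.
rewrite -big_distrr/= [leRHS]mulrAC ler_wpM2l ?mulr_ge0//.
by rewrite geometric_partial_sum_le// ltW.
Qed.

Theorem theorem3p2 (R : realType) :
  (* the positions (k, 2k) and (1, 1 + k) *)
  ((forall k : nat, (0 < k)%N ->
      mxA1 R k.-1 (2 * k).-1 = k%:R^-1 /\ mxA2 R 0%N k = k%:R^-1) /\
   (forall l : nat, dentry (mxA1 R) 0 l = 0 /\ dentry (mxA2 R) 0 l = 0)) /\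
  (* (i) *)
  ((forall k : nat, exists2 s : nat -> nat, bijective s &
      forall l, dentry (mxA1 R) k (s l) = dentry (mxA2 R) k l) /\
   M_S1_21 R (mxA1 R) /\ M_S1_21 R (mxA2 R)) /\
  (* (ii) *)
  (~ kothe_dual (bloch R) (mxA1 R) /\
   bloch R (mxB R) /\ (bloch_norm (mxB R) <= 2%:E)%E /\
   (forall j m : nat, normc (mxA1 R j m * mxB R j m) =
      if m.+1 == (2 * j.+1)%N then j.+1%:R^-1 else 0) /\
   abs_pairing (mxA1 R) (mxB R) = (\sum_(1 <= k <oo) (k%:R^-1)%:E)%E /\
   abs_pairing (mxA1 R) (mxB R) = +oo%E) /\
  (* (iii) *)
  (kothe_dual (bloch R) (mxA2 R) /\
   exists C : R, forall B : imx R, bloch R B ->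
     (abs_pairing (mxA2 R) B <= C%:E * bloch_norm B)%E).
Proof.
split; first split=> [k k0|l].
- rewrite mxA1E mxA2E prednK ?muln_gt0 ?prednK//.
  by rewrite eqxx.
- by rewrite !dentry_of_diagonals.
split.
  split; first exact: diagonals_permuted.
  by split; [exact: mxA1_M_S1_21|exact: mxA2_M_S1_21].
have A1B : abs_pairing (mxA1 R) (mxB R) = +oo%E.
  by rewrite abs_pairing_mxA1_mxB harmonic_nneseries.
split.
  split; first by move=> [_ /(_ _ (mxB_bloch R))]; rewrite A1B ltxx.
  split; first exact: mxB_bloch.
  split; first exact: bloch_norm_mxB.
  split; first exact: normc_mxA1_mxB.
  split=> //; rewrite abs_pairing_mxA1_mxB.
  (* Shift by one: [harmonic] counts from 0, the stated series from 1. *)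
  rewrite -(@nneseries_addn R (fun k => (k%:R^-1)%:E)) => [|k].
    by apply: eq_eseriesr => k _; rewrite addn1.
  by rewrite lee_fin invr_ge0.
split; last by exists (8 * (1 - Num.sqrt 2^-1)^-1) => B; exact: abs_pairing_mxA2_le.
split; first exact: upper_triangular_of_diagonals.
move=> B BB; apply: le_lt_trans (abs_pairing_mxA2_le BB) _.
have [_ _ BN] := BB; have /andP[q0 q1] := sqrt_half_bounds R.
rewrite lte_mul_pinfty// lee_fin mulr_ge0// invr_ge0 subr_ge0 ltW//.
Qed.
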